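(* Fix $z\in Z$. The following statements are equivalent: (i) $\emptyset\neq\mathcal{H}\cap(\{z\}\times\mathbb{R})=\mathcal{N}\cap(\{z\}\times\mathbb{R})$; (ii) $\min\{\langle x,c\rangle: Ax-b-z\in Q,\ x\in P\}=\sup\{\langle b+z,w\rangle:-A^*w+c\in P^*,\ w\in Q^*\}$, where writing $\min$ means that the infimum is attained at some feasible $x$.
   Context: Setting: $(X,Y)$ and $(Z,W)$ are separated dual pairs of real vector spaces, i.e. there are bilinear forms on $X\times Y$ and on $Z\times W$, both denoted $\langle\cdot,\cdot\rangle$, such that $\langle x_0,y\rangle=0$ for all $y\in Y$ implies $x_0=0$, and $\langle x,y_0\rangle=0$ for all $x\in X$ implies $y_0=0$ (and likewise for $(Z,W)$). No topology is assumed. $A:X\to Z$ is a linear map with adjoint $A^*:W\to Y$, a linear map satisfying $\langle x,A^*w\rangle=\langle Ax,w\rangle$ for all $x\in X$, $w\in W$ (assumed to exist). $P\subset X$ and $Q\subset Z$ are convex cones (nonempty, and $\alpha u+\beta v$ is in the cone for all $\alpha,\beta\ge 0$ and $u,v$ in the cone); $b\in Z$, $c\in Y$. Dual cones: $P^*=\{y\in Y:\langle x,y\rangle\ge 0\ \forall x\in P\}$, $Q^*=\{w\in W:\langle q,w\rangle\ge 0\ \forall q\in Q\}$. Feasible sets: $F(\mathcal{P})=\{x\in P: Ax-b\in Q\}$ and $F(\mathcal{D})=\{w\in Q^*:-A^*w+c\in P^*\}$; both are assumed nonempty. Definitions: $\mathcal{H}=\bigcup_{x\in P}\big((Ax-b-Q)\times[\langle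 x,c\rangle,+\infty[\big)\subset Z\times\mathbb{R}$; $v_{\mathcal{D}}(z)=\sup\{\langle b+z,w\rangle:w\in F(\mathcal{D})\}$ for $z\in Z$ (possibly $+\infty$); $\mathcal{N}=\mathrm{epi}\,v_{\mathcal{D}}=\{(z,r)\in Z\times\mathbb{R}: v_{\mathcal{D}}(z)\le r\}$. *)

(* Defs.v *)
From mathcomp Require Import all_boot all_order all_algebra.
From mathcomp Require Import classical_sets boolp set_interval reals.
From mathcomp Require Import constructive_ereal ereal.

Set Implicit Arguments.
Unset Strict Implicit.
Unset Printing Implicit Defensive.

Import Order.TTheory GRing.Theory Num.Theory.

Local Open Scope classical_set_scope.
Local Open Scope ring_scope.

Notation "{ 'pairing' U , V }" := {bilinear U -> V -> _ | *%R & *%R}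
  (at level 0, U at level 98, V at level 98,
   format "{ 'pairing'  U ,  V }") : type_scope.

Definition separated_pairing (R : realType) (U V : lmodType R)
    (f : {pairing U, V}) : Prop :=
  (forall u0 : U, (forall v : V, f u0 v = 0) -> u0 = 0) /\
  (forall v0 : V, (forall u : U, f u v0 = 0) -> v0 = 0).

Definition adjoint_of (R : realType) (X Y Z W : lmodType R)
    (xy : {pairing X, Y}) (zw : {pairing Z, W})
    (A : X -> Z) (As : W -> Y) : Prop :=
  forall (x : X) (w : W), xy x (As w) = zw (A x) w.

Definition convex_cone (R : realType) (V : lmodType R) (K : set V) : Prop :=
  K !=set0 /\
  forall (a b : R) (u v : V),
    0 <= a -> 0 <= b -> K u -> K v -> K (a *: u + b *: v).

Definition dual_cone (R : realType) (U V : lmodType R)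
    (f : {pairing U, V}) (K : set U) : set V :=
  [set v | forall u, K u -> 0 <= f u v].

Definition epigraph (R : realType) (T : Type) (g : T -> \bar R) : set (T * R) :=
  [set p | (g p.1 <= p.2%:E)%E].

Section ConicProgram.
Variables (R : realType) (X Y Z W : lmodType R).
Variables (xy : {pairing X, Y}) (zw : {pairing Z, W}).
Variables (A : {linear X -> Z}) (As : {linear W -> Y}).
Variables (P : set X) (Q : set Z) (b : Z) (c : Y).

Definition primal_feasible : set X := [set x | P x /\ Q (A x - b)].

Definition dual_feasible : set W :=
  [set w | dual_cone zw Q w /\ dual_cone xy P (- As w + c)].

Definition setH : set (Z * R) :=
  \bigcup_(x in P) ([set A x - b - q | q in Q] `*` `[xy x c, +oo[).

Definition dual_value (z : Z) : \bar R :=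
  ereal_sup [set (zw (b + z) w)%:E | w in dual_feasible].

Definition setN : set (Z * R) := epigraph dual_value.

End ConicProgram.

(* Main.v *)
Require Import Defs.
From mathcomp Require Import all_boot all_order all_algebra.
From mathcomp Require Import classical_sets boolp set_interval reals.
From mathcomp Require Import constructive_ereal ereal.

Set Implicit Arguments.
Unset Strict Implicit.
Unset Printing Implicit Defensive.

(** Over a fixed z, both sets are up-closed sets of heights read off from the
    perturbed programs: a point (z, r) lies in the primal set exactly when some
    feasible x has cost at most r ([setH_sliceP]), and in the dual epigraph
    exactly when the dual value at z is at most r.  The dual value is above -oo
    because the dual program is feasible.  The theorem is thus a fact about a
    set S of real costs and an extended real d > -oo: S is nonempty with
    up-closure {r | d <= r} if and only if d is the least element of S
    ([upclosure_halflineP]).  Either side carries the weak duality inequality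
    within itself, since S is contained in its own up-closure. *)

Import Order.TTheory GRing.Theory Num.Theory.

Local Open Scope classical_set_scope.
Local Open Scope ring_scope.

(** Any cost bounds d from above, so d is a real number and hence a point of
    its own half-line {r | d <= r}.  Some cost is therefore at most d, while
    every cost is at least d: this cost is d itself, and it is minimal. *)
Lemma upclosure_halflineP (R : realType) (T : Type) (S : set T) (f : T -> R)
    (d : \bar R) :
  (-oo < d)%E ->
  ((exists x, S x) /\
   (forall r : R, (exists2 x, S x & f x <= r) <-> (d <= r%:E)%E))
  <->
  ((exists2 x, S x & (f x)%:E = ereal_inf [set (f y)%:E | y in S]) /\
   ereal_inf [set (f y)%:E | y in S] = d).
Proof.
move=> d_gtNy; set m := ereal_inf _.
split=> [[[x0 Sx0] Sd]|[[x Sx fxm] md]]; last first.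
  split=> [|r]; first by exists x.
  rewrite -md; split=> [[y Sy fyr]|mr]; last first.
    by exists x => //; rewrite -lee_fin fxm.
  apply: (@le_trans _ _ (f y)%:E); last by rewrite lee_fin.
  by apply: ereal_inf_lbound; exists y.
have d_lb y : S y -> (d <= (f y)%:E)%E by move=> Sy; apply/Sd; exists y.
have [s ds] : exists s, d = s%:E.
  by case: d d_gtNy {Sd} d_lb => [s||] // _ /(_ _ Sx0) //; exists s.
have [x Sx fxs] : exists2 x, S x & f x <= s by apply/Sd; rewrite ds.
have dm : (d <= m)%E by apply: le_ereal_inf_tmp => _ [y Sy <-]; apply: d_lb.
have mfx : (m <= (f x)%:E)%E by apply: ereal_inf_lbound; exists x.
have fxd : ((f x)%:E <= d)%E by rewrite ds lee_fin.
split; last by apply/le_anti; rewrite dm (le_trans mfx fxd).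
by exists x => //; apply/le_anti; rewrite mfx (le_trans fxd dm).
Qed.

(** The cone element q with A x - b - q = z is determined by x, which turns
    the union defining the primal set into a feasibility condition on x. *)
Lemma setH_sliceP (R : realType) (X Y Z : lmodType R) (xy : {pairing X, Y})
    (A : {linear X -> Z}) (P : set X) (Q : set Z) (b : Z) (c : Y)
    (z : Z) (r : R) :
  setH xy A P Q b c (z, r) <->
  (exists2 x, Q (A x - b - z) /\ P x & xy x c <= r).
Proof.
split=> [[x Px [/= [q Qq <-]]]|[x [Qx Px] xr]].
  rewrite in_itv /= andbT => xr; exists x => //; split=> //.
  by rewrite subKr.
exists x => //; split=> /=; last by rewrite in_itv /= andbT.
by exists (A x - b - z) => //; rewrite subKr.
Qed.

Lemma slice_eqP (T U : Type) (H N : set (T * U)) (z : T) :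
  H `&` ([set z] `*` setT) = N `&` ([set z] `*` setT) <->
  (forall r, H (z, r) <-> N (z, r)).
Proof.
split=> [HN r|HN].
  have mem E : (E `&` ([set z] `*` setT)) (z, r) <-> E (z, r).
    by split=> [[]|]; last by split.
  by apply: iff_trans (mem N); rewrite -HN; apply: iff_sym; exact: mem.
by apply/seteqP; split=> -[z' r] [+ [/= zz' _]]; rewrite zz' => h;
  split=> //; apply/HN.
Qed.

Theorem theorem4p5 (R : realType) (X Y Z W : lmodType R)
    (xy : {pairing X, Y}) (zw : {pairing Z, W})
    (A : {linear X -> Z}) (As : {linear W -> Y})
    (P : set X) (Q : set Z) (b : Z) (c : Y)
    (xy_separated : separated_pairing xy) 
    (zw_separated : separated_pairing zw)
    (As_adjoint : adjoint_of xy zw A As)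
    (P_cone : convex_cone P) (Q_cone : convex_cone Q)
    (FP_nonempty : primal_feasible A P Q b !=set0)
    (FD_nonempty : dual_feasible xy zw As P Q c !=set0)
    (z : Z) :
  let H := setH xy A P Q b c in
  let N := setN xy zw As P Q b c in
  let FPz : set X := [set x | Q (A x - b - z) /\ P x] in
  let primal_inf : \bar R := ereal_inf [set (xy x c)%:E | x in FPz] in
  let dual_sup : \bar R :=
    ereal_sup [set (zw (b + z) w)%:E | w in
      [set w | dual_cone xy P (- As w + c) /\ dual_cone zw Q w]] in
  (H `&` ([set z] `*` setT) !=set0 /\
   H `&` ([set z] `*` setT) = N `&` ([set z] `*` setT))
  <->
  ((exists2 x, FPz x & (xy x c)%:E = primal_inf) /\ primal_inf = dual_sup).
Proof.
move=> H N FPz primal_inf dual_sup.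
(* The two feasible sets of the dual differ by the order of a conjunction. *)
have dualE : dual_value xy zw As P Q b c z = dual_sup.
  by congr (ereal_sup (image _ _)); apply/seteqP; split=> w [? ?]; split.
have dual_gtNy : (-oo < dual_sup)%E.
  have [w Fw] := FD_nonempty.
  rewrite -dualE; apply: (@lt_le_trans _ _ (zw (b + z) w)%:E).
    exact: ltNyr.
  by apply: ereal_sup_ubound; exists w.
have NP r : N (z, r) <-> (dual_sup <= r%:E)%E by rewrite -dualE.
have HP r : H (z, r) <-> exists2 x, FPz x & xy x c <= r by exact: setH_sliceP.
apply: iff_trans (upclosure_halflineP FPz (xy^~ c) dual_gtNy).
split=> [[[[z' r] [Hzr [/= zz' _]]] /slice_eqP HN]|[[x Fx] HN]].
  split=> [|s]; last by apply: iff_trans (NP s); apply: iff_trans (HN s);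
    apply: iff_sym; exact: HP.
  by rewrite zz' in Hzr; have /HP[x Fx _] := Hzr; exists x.
split; last first.
  by apply/slice_eqP => s; apply: iff_trans (HP s) _;
    apply: iff_trans (HN s) _; apply: iff_sym; exact: NP.
by exists (z, xy x c); split=> //; apply/HP; exists x.
Qed.
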